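(* Let $0<p<\frac{e^{-1/2}}{1+e^{-1/2}}$. Then for all $t\in(p,1)$ sufficiently close to $1$ (i.e. there is $t_0=t_0(p)<1$ such that for all $t\in(p,1)$ with $t>t_0$), if $(p,t)$ belongs to the replica symmetric phase, the importance sampling scheme (for the event $\mathcal{W}_t$ under $\mathbb{P}_{n,p}$) based on the edge tilt $\mathbb{Q}_n^{h_t,0}$, $h_t=\log\frac{t}{1-t}$, is not asymptotically optimal.
   Context: **Graphons.** $\mathcal{W}$ is the set of measurable symmetric functions $f:[0,1]^2\to[0,1]$, modulo identifying $f$ and $g$ when $f(x,y)=g(\sigma x,\sigma y)$ for a measure-preserving bijection $\sigma$ of $[0,1]$ (functions equal a.e. are identified). For $f\in\mathcal{W}$: $\mathcal{T}(f)=\int\int\int f(x,y)f(y,z)f(x,z)\,dx\,dy\,dz$ (integrals over $[0,1]$), and $\mathcal{W}_t=\{f\in\mathcal{W}:\mathcal{T}(f)\ge t^3\}$. **Rate function.** $I_p(u)=\frac12\left(u\log\frac up+(1-u)\log\frac{1-u}{1-p}\right)$ for $u\in[0,1]$ (with $0\log 0=0$), and $\mathcal{I}_p(f)=\int_0^1\int_0^1I_p(f(x,y))\,dx\,dy$. **Replica symmetric phase.** $(p,t)$ belongs to the replica symmetric phase if $\inf_{f\in\mathcal{W}_t}\mathcal{I}_p(f)=I_p(t)$ and the infimum is uniquely attained at the constant function $t$. **Graphs.** $\Omega_n=\{0,1\}^{\binom n2}$ is the set of simple graphs $X$ on $n$ vertices. $X$ is identified with the graphon equal to $X_{ij}$ on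 $[\frac{i-1}n,\frac in)\times[\frac{j-1}n,\frac jn)$ ($X_{ji}=X_{ij}$, $X_{ii}=0$), so $\mathcal{T}(X)=\frac6{n^3}\#\{\text{triangles of }X\}$. $\mathbb{P}_{n,p}$ is the law of the Erdős–Rényi graph $\mathcal{G}_{n,p}$ (independent edges with probability $p$). **Edge tilt.** $\mathbb{Q}_n^{h,0}$ is the probability measure on $\Omega_n$ with $\mathbb{Q}_n^{h,0}(X)\propto e^{hE(X)}$, $E(X)$ the number of edges of $X$; for $h=h_t$ this is $\mathbb{P}_{n,t}$. **Asymptotic optimality.** Importance sampling based on $\mathbb{Q}_n$ estimates $\mathbb{P}_{n,p}(\mathcal{W}_t)$ by averaging $\mathbf{1}_{\mathcal{W}_t}(\tilde X)\frac{d\mathbb{P}_{n,p}}{d\mathbb{Q}_n}(\tilde X)$ over i.i.d. samples $\tilde X\sim\mathbb{Q}_n$. The scheme based on $\mathbb{Q}_n$ is asymptotically optimal if $$\lim_{n\to\infty}\frac1{n^2}\log\mathbb{E}_{\mathbb{Q}_n}\left[\left(\mathbf{1}_{\mathcal{W}_t}\frac{d\mathbb{P}_{n,p}}{d\mathbb{Q}_n}\right)^2\right]=-2\inf_{f\in\mathcal{W}_t}\mathcal{I}_p(f).$$ *)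

(* Defs.v *)
From HB Require Import structures.
From mathcomp Require Import all_boot all_order all_algebra.
From mathcomp Require Import all_classical all_reals all_analysis.
Set Implicit Arguments.
Unset Strict Implicit.
Unset Printing Implicit Defensive.
Import Order.TTheory GRing.Theory Num.Theory.
Import numFieldNormedType.Exports.
Local Open Scope classical_set_scope.
Local Open Scope ring_scope.

Section Graphons.
Variable R : realType.
Implicit Types (f g : R * R -> R) (p t : R).

Definition unit_itv : set R := `[0, 1]%classic.

Local Notation mu := (@lebesgue_measure R).
Local Notation I := unit_itv.

(* Only the values on [0,1]^2 matter; outside the square f is arbitrary.
   Elements of the quotient space of graphons are handled through their
   representatives, up to [graphon_equiv] below. *)
Definition is_graphon f : Prop :=
  [/\ measurable_fun (I `*` I) (f : measurableTypeR R * measurableTypeR R -> R),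
      forall x y, I x -> I y -> f (x, y) = f (y, x) &
      forall x y, I x -> I y -> 0 <= f (x, y) <= 1].

Definition measure_preserving_bij (s : R -> R) : Prop :=
  [/\ set_bij I I s, measurable_fun I s &
      forall A : set R, measurable A -> A `<=` I -> mu (I `&` s @^-1` A) = mu A].

Definition graphon_equiv f g : Prop :=
  exists2 s : R -> R, measure_preserving_bij s &
    {ae (mu \x mu)%E, forall z : R * R,
       (I `*` I) z -> f z = g (s z.1, s z.2)}.

Definition triangle_density f : R :=
  \int[mu]_(x in I) \int[mu]_(y in I) \int[mu]_(z in I)
    (f (x, y) * f (y, z) * f (x, z)).

Definition upper_tail t : set (R * R -> R) :=
  [set f | is_graphon f /\ t ^+ 3 <= triangle_density f].

(* The convention 0 log 0 = 0 holds because [ln 0 = 0]. *)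
Definition Ip p (u : R) : R :=
  2^-1 * (u * ln (u / p) + (1 - u) * ln ((1 - u) / (1 - p))).

Definition rate p f : R :=
  \int[mu]_(x in I) \int[mu]_(y in I) Ip p (f (x, y)).

(* For 0 < p < 1 the rate is nonnegative, and for t <= 1 the set contains the
   constant 1, so that the real infimum [inf] is the genuine one. *)
Definition inf_rate p t : R := inf [set rate p f | f in upper_tail t].

Definition replica_symmetric p t : Prop :=
  inf_rate p t = Ip p t /\
  forall f, upper_tail t f ->
    (rate p f = inf_rate p t <-> graphon_equiv f (cst t)).

End Graphons.

Definition edge (n : nat) := {e : 'I_n * 'I_n | (e.1 < e.2)%N}.

Definition graph (n : nat) := {ffun edge n -> bool}.

Definition adj (n : nat) (X : graph n) (i j : 'I_n) : bool :=
  [exists e : edge n, X e && ((val e == (i, j)) || (val e == (j, i)))].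

Definition num_edges (n : nat) (X : graph n) : nat := #|[pred e | X e]|.

Section RandomGraphs.
Variable R : realType.

(* Indices start at 0, so cell i is [i/n, (i+1)/n). *)
Definition cell (n : nat) (i : 'I_n) : set R :=
  `[(i%:R / n%:R), (i.+1%:R / n%:R)[%classic.

Definition graphon_of (n : nat) (X : graph n) (z : R * R) : R :=
  \sum_(i < n) \sum_(j < n)
    (adj X i j)%:R * \1_(cell i) z.1 * \1_(cell j) z.2.

(* Probability measures on the finite set [graph n] are given by their mass
   functions. *)
Definition erdos_renyi (n : nat) (p : R) (X : graph n) : R :=
  \prod_(e : edge n) (if X e then p else 1 - p).

Definition edge_tilt (n : nat) (h : R) (X : graph n) : R :=
  expR (h * (num_edges X)%:R) /
  \sum_(Y : graph n) expR (h * (num_edges Y)%:R).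

Definition expectation_fin (n : nat) (Q F : graph n -> R) : R :=
  \sum_(X : graph n) Q X * F X.

Definition second_moment (p t : R) (n : nat) (Q : graph n -> R) : R :=
  expectation_fin Q
    (fun X => (\1_(upper_tail t) (graphon_of X) * (erdos_renyi p X / Q X)) ^+ 2).

Definition asymptotically_optimal (p t : R) (Q : forall n, graph n -> R) :
    Prop :=
  (fun n => ln (second_moment p t (Q n)) / n%:R ^+ 2) @ \oo
    --> - 2 * inf_rate p t.

Definition logit (t : R) : R := ln (t / (1 - t)).

End RandomGraphs.

(* Main.v *)
Require Import Defs.
From mathcomp Require Import all_boot all_order all_algebra.
From mathcomp Require Import all_classical all_reals all_analysis.
From mathcomp Require Import measurable_realfun ring lra.
Import Order.TTheory GRing.Theory Num.Theory.
Import numFieldNormedType.Exports.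
Local Open Scope ring_scope.

(** Under the tilt, which is G(n, t), the second moment is the sum of
    P(X)^2 / Q(X) over the graphs X in the upper tail, so each such X gives a
    lower bound (second_moment_ge). Optimality fails because of a graph which is
    very unlikely under G(n, t): a clique on slightly more than t n vertices,
    with no other edge. It has triangle density at least t^3
    (clique_upper_tail), and its missing edges, a proportion 1 - t^2 of all
    pairs where G(n, t) only lacks a proportion 1 - t, each cost a factor 1 - t
    in the denominator Q(X).

    Since P(X)^2 / Q(X) is a product over the pairs of vertices, the clique
    alone gives the exponential rate
      clique_rate p t = (t^2 ln (p^2 / t) + (1 - t^2) ln ((1-p)^2 / (1-t))) / 2,
    whereas in the replica symmetric phase optimality would force the rate
    - 2 I_p(t). Both equal ln p at t = 1. To first order in s = 1 - t the
    difference, clique rate minus - 2 I_p(t), is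
      s (ln ((1-p) / p) - 1/2),
    and ln ((1-p) / p) > 1/2 is precisely the hypothesis
    p < e^(-1/2) / (1 + e^(-1/2)). The lemma clique_rate_gt makes this expansion
    quantitative, with the explicit threshold t0. *)

(** * Step functions on the cells *)

Definition step {R : realType} {n : nat} (c : 'I_n -> R) (x : R) : R :=
  \sum_(i < n) c i * \1_(@cell R n i) x.

Lemma cell_inj (R : realType) n (x : R) (i j : 'I_n) :
  @cell R n i x -> @cell R n j x -> i = j.
Proof.
rewrite /cell /= !in_itv /= => /andP[ix xi] /andP[jx xj].
have n_gt0 : 0 < n%:R :> R by rewrite ltr0n; case: n i {j ix xi jx xj} => [[]|].
have := le_lt_trans ix xj; have := le_lt_trans jx xi.
rewrite !ltr_pM2r ?invr_gt0// !ltr_nat !ltnS => ji ij.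
by apply/val_inj/eqP; rewrite eqn_leq ij ji.
Qed.

(** As the cells are disjoint, a step function is evaluation at a single index,
    or zero off the cells. All the algebra of step functions (products, sums,
    nested steps) reduces to algebra of coefficients by this case analysis. *)
Lemma step_eval (R : realType) n (x : R) :
  (forall c : 'I_n -> R, step c x = 0) \/
  exists i, forall c : 'I_n -> R, step c x = c i.
Proof.
have [[i xi]|none] := pselect (exists i : 'I_n, @cell R n i x); [right|left].
  exists i => c.
  rewrite /step (bigD1 i)//= indicE mem_set// mulr1 big1 ?addr0//.
  move=> j ji; rewrite indicE memNset ?mulr0// => xj.
  by move/eqP: ji; apply; apply: cell_inj xj xi.
move=> c; rewrite /step big1// => i _.
by rewrite indicE memNset ?mulr0// => xi; apply: none; exists i.
Qed.

Lemma stepM (R : realType) n (c d : 'I_n -> R) x :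
  step c x * step d x = step (fun i => c i * d i) x.
Proof. by case: (step_eval R n x) => [E|[i E]]; rewrite !E ?mulr0. Qed.

Lemma step_mull (R : realType) n a (c : 'I_n -> R) x :
  a * step c x = step (fun i => a * c i) x.
Proof. by case: (step_eval R n x) => [E|[i E]]; rewrite !E ?mulr0. Qed.

Lemma step_bounded (R : realType) n (c : 'I_n -> R) x :
  (forall i, 0 <= c i <= 1) -> 0 <= step c x <= 1.
Proof.
by move=> c01; case: (step_eval R n x) => [E|[i E]]; rewrite E ?lexx ?ler01.
Qed.

Lemma lebesgue_measure_cell (R : realType) n (i : 'I_n) :
  lebesgue_measure (@cell R n i `&` @unit_itv R) = (n%:R^-1)%:E.
Proof.
have n_gt0 : 0 < n%:R :> R by rewrite ltr0n; case: n i => [[]|].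
rewrite setIidl; last first.
  move=> x; rewrite /cell /unit_itv /= !in_itv /= => /andP[ix xi].
  rewrite (le_trans _ ix) ?divr_ge0//=.
  by rewrite (le_trans (ltW xi))// ler_pdivrMr// mul1r ler_nat.
rewrite /cell lebesgue_measure_itv /= lte_fin ltr_pM2r ?invr_gt0//.
rewrite ltr_nat ltnSn -EFinD -mulrBl -natrB ?leqnSn// subSnn mul1r//.
Qed.

Lemma measurable_cell (R : realType) n (i : 'I_n) :
  measurable (@cell R n i : set (measurableTypeR R)).
Proof. exact: measurable_itv. Qed.

Lemma Rintegral_step (R : realType) n (c : 'I_n -> R) :
  \int[@lebesgue_measure R]_(x in @unit_itv R) step c x = (\sum_i c i) / n%:R.
Proof.
have mI : measurable (@unit_itv R : set (measurableTypeR R)).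
  exact: measurable_itv.
have int_ind i : (@lebesgue_measure R).-integrable (@unit_itv R)
    (fun x => (\1_(@cell R n i) x)%:E)%E.
  by apply: (@integrableS _ _ _ _ setT) => //; exact: integrable_indic_itv.
have int_cell i : (@lebesgue_measure R).-integrable (@unit_itv R)
    (fun x => (c i)%:E * (\1_(@cell R n i) x)%:E)%E by exact: integrableZl.
have intE i : (\int[@lebesgue_measure R]_(x in @unit_itv R)
    ((c i)%:E * (\1_(@cell R n i) x)%:E) = (c i / n%:R)%:E)%E.
  rewrite integralZl// integral_indic//; last exact: measurable_cell.
  by rewrite EFinM; congr (_ * _)%E; exact: lebesgue_measure_cell.
rewrite /Rintegral.
under eq_integral do rewrite /step -sumEFin.
rewrite (integral_sum mI int_cell) (eq_bigr _ (fun i _ => intE i)).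
by rewrite sumEFin -mulr_suml.
Qed.

(** * The graphon of a graph *)

Section graphon_of_graph.
Variables (R : realType) (n : nat) (X : graph n).
Local Notation a i j := ((adj X i j)%:R : R).

Lemma adj_sym (i j : 'I_n) : adj X i j = adj X j i.
Proof. by apply: eq_existsb => e; rewrite orbC. Qed.

Lemma graphon_of_step x y :
  graphon_of X (x, y) = step (fun i => step (fun j => a i j) y) x.
Proof.
apply: eq_bigr => i _; rewrite /step mulr_suml; apply: eq_bigr => j _ /=.
by rewrite mulrAC.
Qed.

Lemma graphon_of_sym (x y : R) : graphon_of X (x, y) = graphon_of X (y, x).
Proof.
rewrite /graphon_of exchange_big; apply: eq_bigr => i _; apply: eq_bigr => j _.
by rewrite adj_sym mulrAC.
Qed.

Lemma graphon_of_is_graphon : is_graphon (@graphon_of R n X).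
Proof.
split=> [|x y _ _|x y _ _]; last 2 first.
- exact: graphon_of_sym.
- rewrite graphon_of_step; apply: step_bounded => i; apply: step_bounded => j.
  by case: (adj X i j); rewrite ?lexx ?ler01.
apply: measurable_sum => i; apply: measurable_sum => j.
have mcell (k : 'I_n) : measurable_fun setT (\1_(@cell R n k) : R -> R).
  by apply: measurable_indic; exact: measurable_cell.
apply: measurable_funM; first apply: measurable_funM => //.
- apply: measurable_funTS; apply: measurableT_comp; first exact: mcell.
  exact: measurable_fst.
- apply: measurable_funTS; apply: measurableT_comp; first exact: mcell.
  exact: measurable_snd.
Qed.

(** In each of the three variables in turn, the innermost one first, the
    integrand is a step function: its integral is the mean of its
    coefficients. *)
Lemma triangle_density_graphon_of :
  triangle_density (@graphon_of R n X) =
  (\sum_(i < n) \sum_(j < n) \sum_(k < n) a i j * a j k * a i k) / n%:R ^+ 3.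
Proof.
have colE x y : graphon_of X (x, y) = step (fun j => step (fun i => a i j) x) y.
  rewrite graphon_of_sym graphon_of_step.
  apply: eq_bigr => i _; congr (_ * _).
  by apply: eq_bigr => j _; rewrite adj_sym.
pose col x k := step (fun i => a i k) x.
transitivity (\int[@lebesgue_measure R]_(x in @unit_itv R)
  step (fun i => (\sum_j (\sum_k a i j * a j k * a i k) / n%:R) / n%:R) x).
  apply: eq_Rintegral => x _.
  transitivity (\int[@lebesgue_measure R]_(y in @unit_itv R)
    step (fun j => (\sum_k col x j * a j k * col x k) / n%:R) y).
    apply: eq_Rintegral => y _.
    transitivity (\int[@lebesgue_measure R]_(z in @unit_itv R)
      step (fun k => graphon_of X (x, y) * col y k * col x k) z).
      apply: eq_Rintegral => z _; rewrite (colE y) (colE x z).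
      rewrite -mulrA stepM step_mull.
      by apply: eq_bigr => k _; rewrite mulrA.
    rewrite Rintegral_step colE /col.
    case: (step_eval R n y) => [E|[j E]]; rewrite !E.
      by rewrite big1 ?mul0r// => k _; rewrite E !mul0r.
    by congr (_ / _); apply: eq_bigr => k _; rewrite E.
  rewrite Rintegral_step /col.
  case: (step_eval R n x) => [E|[i E]]; rewrite !E.
    rewrite big1 ?mul0r// => j _; rewrite big1 ?mul0r// => k _.
    by rewrite E !mul0r.
  congr (_ / _); apply: eq_bigr => j _; congr (_ / _).
  by apply: eq_bigr => k _; rewrite !E.
rewrite Rintegral_step.
under eq_bigr do rewrite -mulr_suml.
by rewrite -!mulr_suml -!mulrA -!invfM -expr2 -exprS.
Qed.
End graphon_of_graph.

(** * Counting edges and triangles in a clique *)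

Definition clique (n m : nat) : graph n :=
  [ffun e : edge n => ((val e).2 < m)%N].

Lemma adj_clique n m (i j : 'I_n) :
  adj (clique n m) i j = [&& i != j, (i < m)%N & (j < m)%N].
Proof.
apply/existsP/and3P => [[e /andP[]]|[ij im jm]].
  rewrite ffunE => em /orP[] /eqP ve; have := valP e; rewrite ve /= in em *.
    by move=> ij; split=> //; [rewrite -val_eqE ltn_eqF|exact: ltn_trans em].
  by move=> ij; split=> //; [rewrite -val_eqE gtn_eqF|exact: ltn_trans em].
rewrite neq_ltn in ij; case/orP: ij => ij.
  by exists (exist _ (i, j) ij); rewrite ffunE /= jm eqxx.
by exists (exist _ (j, i) ij); rewrite ffunE /= im eqxx orbT.
Qed.

Lemma card_edges_below n m : (m <= n)%N ->
  #|[pred e : edge n | ((val e).2 < m)%N]| = 'C(m, 2).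
Proof.
move=> mn; rewrite -sum1_card.
rewrite -(@big_sub_cond _ _ _ _ [pred e : 'I_n * 'I_n | (e.1 < e.2)%N]
  [pred e : 'I_n * 'I_n | (e.2 < m)%N] (fun=> 1%N)) /=.
rewrite (eq_bigl (fun e : 'I_n * 'I_n => (e.2 < m)%N && (e.1 < e.2)%N));
  last first.
  by move=> e; rewrite !inE andbC.
transitivity (\sum_(j < n | (j < m)%N) \sum_(i < n | (i < j)%N) 1)%N.
  rewrite (exchange_big_dep xpredT)//= pair_big_dep; exact: eq_bigl.
rewrite -bin2_sum big_mkord (big_ord_widen n id mn).
apply: eq_bigr => j _.
by rewrite -(big_ord_widen n (fun=> 1%N) (ltnW (ltn_ord j))) sum1_card card_ord.
Qed.

Lemma card_edge n : #|{: edge n}| = 'C(n, 2).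
Proof.
rewrite -(card_edges_below n n (leqnn n)); apply: eq_card => e.
by rewrite !inE ltn_ord.
Qed.

Lemma num_edges_clique n m : (m <= n)%N -> num_edges (clique n m) = 'C(m, 2).
Proof.
move=> mn; rewrite -(card_edges_below n m mn); apply: eq_card => e.
by rewrite !inE ffunE.
Qed.

Lemma bin2r (R : realType) n : 'C(n, 2)%:R = n%:R * (n%:R - 1) / 2 :> R.
Proof.
case: n => [|n]; first by rewrite mul0r mul0r.
apply: (canRL (mulfK _)); first by rewrite pnatr_eq0.
by rewrite -natrM bin_ffact ffactnS ffactn1 natrM -(natrB _ (ltn0Sn n)) subn1.
Qed.

Lemma sum_kronecker (R : realType) n (f : 'I_n -> R) i :
  \sum_(k < n) (i == k)%:R * f k = f i.
Proof.
rewrite (bigD1 i)//= eqxx mul1r big1 ?addr0// => k.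
by rewrite eq_sym => /negPf->; rewrite mul0r.
Qed.

(** The exact value is m (m - 1) (m - 2). The weaker bound suffices, and it comes
    from a termwise inequality: ordered triples of clique vertices, minus those
    with two prescribed entries equal. *)
Lemma clique_triangles_ge (R : realType) n m : (m <= n)%N ->
  m%:R ^+ 3 - 3 * m%:R ^+ 2 <=
  \sum_(i < n) \sum_(j < n) \sum_(k < n)
    (adj (clique n m) i j)%:R * (adj (clique n m) j k)%:R
    * (adj (clique n m) i k)%:R :> R.
Proof.
move=> mn; pose d (i : 'I_n) : R := (i < m)%N%:R.
have sumd : \sum_i d i = m%:R.
  rewrite -natr_sum; congr _%:R.
  by rewrite -(big_mkcond (fun i : 'I_n => (i < m)%N) (fun=> 1%N))
    -(big_ord_widen n (fun=> 1%N) mn) sum1_card card_ord.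
pose del (i j : 'I_n) : R := (i == j)%:R.
have sumk i j : \sum_k (d i * d j * d k - del i j * (d i * d k)
    - del j k * (d i * d k) - del i k * (d j * d k)) =
    d i * m%:R * d j - del i j * (d i * m%:R) - d i * d j - d i * d j.
  rewrite !sumrB !sum_kronecker -!mulr_sumr sumd; ring.
have sumj i : \sum_j (d i * m%:R * d j - del i j * (d i * m%:R)
    - d i * d j - d i * d j) = (m%:R ^+ 2 - 3 * m%:R) * d i.
  rewrite !sumrB !sum_kronecker -!mulr_sumr sumd; ring.
have -> : m%:R ^+ 3 - 3 * m%:R ^+ 2 = \sum_i \sum_j \sum_k
    (d i * d j * d k - del i j * (d i * d k) - del j k * (d i * d k)
     - del i k * (d j * d k)).
  under eq_bigr do (under eq_bigr do rewrite sumk).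
  under eq_bigr do rewrite sumj.
  rewrite -mulr_sumr sumd; ring.
apply: ler_sum => i _; apply: ler_sum => j _; apply: ler_sum => k _.
rewrite !adj_clique /d /del.
case: (i == j); case: (j == k); case: (i == k);
case: (i < m)%N; case: (j < m)%N; case: (k < m)%N => /=; lra.
Qed.

(** Three vertices beyond t n absorb the triples with a repeated entry:
    m^3 - 3 m^2 = (m - 3) m^2 is then at least (t n)^3. *)
Lemma clique_upper_tail (R : realType) n m (t : R) : (m <= n)%N -> (0 < n)%N ->
  0 <= t -> t * n%:R <= m%:R - 3 -> upper_tail t (@graphon_of R n (clique n m)).
Proof.
move=> mn n_gt0 t0 tm; split; first exact: graphon_of_is_graphon.
have n0 : 0 < n%:R :> R by rewrite ltr0n.
rewrite triangle_density_graphon_of ler_pdivlMr ?exprn_gt0// -exprMn.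
apply: le_trans (@clique_triangles_ge R n m mn).
have tn0 : 0 <= t * n%:R by rewrite mulr_ge0// ltW.
have tm' : t * n%:R <= m%:R by lra.
have -> : m%:R ^+ 3 - 3 * m%:R ^+ 2 = (m%:R - 3) * m%:R ^+ 2 :> R by ring.
rewrite exprS ler_pM// ?exprn_ge0// lerXn2r ?nnegrE//.
Qed.

(** * Edge tilts and the second moment *)

Lemma prod_edges (R : realType) n (X : graph n) (a b : R) :
  \prod_(e : edge n) (if X e then a else b) =
  a ^+ num_edges X * b ^+ (#|{: edge n}| - num_edges X).
Proof.
rewrite (bigID (fun e => X e))/=; congr (_ * _).
  rewrite (eq_bigr (fun=> a)); last by move=> e ->.
  by rewrite prodr_const.
rewrite (eq_bigr (fun=> b)); last by move=> e /negbTE->.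
rewrite prodr_const; congr (_ ^+ _).
rewrite /num_edges -(cardC [pred e | X e]) addKn.
by apply: eq_card => e.
Qed.

(** Both the Gibbs weight and the partition function factor over the edges, the
    latter by distributivity: each edge contributes 1 + t / (1 - t). *)
Lemma edge_tilt_logit (R : realType) n (t : R) (X : graph n) : 0 < t < 1 ->
  edge_tilt (logit t) X = erdos_renyi t X.
Proof.
move=> /andP[t0 t1]; have s0 : 0 < 1 - t by rewrite subr_gt0.
have expE (Y : graph n) : expR (logit t * (num_edges Y)%:R) =
    \prod_(e : edge n) (if Y e then t / (1 - t) else 1).
  rewrite prod_edges expr1n mulr1 expRM_natr /logit lnK//.
  by rewrite posrE divr_gt0.
have sumE : \sum_(Y : graph n) expR (logit t * (num_edges Y)%:R) =
    \prod_(e : edge n) (1 - t)^-1.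
  under eq_bigr do rewrite expE.
  rewrite -(bigA_distr_bigA
    (fun (e : edge n) b => if b then t / (1 - t) else 1)).
  apply: eq_bigr => e _; rewrite big_bool /=; field; lra.
rewrite /edge_tilt expE sumE -prodf_div; apply: eq_bigr => e _.
by case: (X e); field; lra.
Qed.

Lemma second_moment_ge (R : realType) n (p t : R) (Q : graph n -> R)
    (X : graph n) :
  (forall Y, 0 <= Q Y) -> Q X != 0 -> upper_tail t (@graphon_of R n X) ->
  erdos_renyi p X ^+ 2 / Q X <= second_moment p t Q.
Proof.
move=> Q0 QX tX; rewrite /second_moment /expectation_fin (bigD1 X)//=.
rewrite indicE mem_set// mul1r -[leLHS]addr0 lerD//.
  by rewrite le_eqVlt; apply/orP; left; apply/eqP; field.
by apply: sumr_ge0 => Y _; rewrite mulr_ge0// sqr_ge0.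
Qed.

Lemma erdos_renyi_gt0 (R : realType) n (p : R) (X : graph n) : 0 < p < 1 ->
  0 < erdos_renyi p X.
Proof. by move=> ?; apply: prodr_gt0 => e _; case: ifP => _; lra. Qed.

Lemma ln_weight (R : realType) n (p t : R) (X : graph n) :
  0 < p < 1 -> 0 < t < 1 ->
  ln (erdos_renyi p X ^+ 2 / erdos_renyi t X) =
  (num_edges X)%:R * ln (p ^+ 2 / t) +
  ('C(n, 2)%:R - (num_edges X)%:R) * ln ((1 - p) ^+ 2 / (1 - t)).
Proof.
move=> p01 t01.
have -> : erdos_renyi p X ^+ 2 / erdos_renyi t X =
    \prod_(e : edge n) (if X e then p ^+ 2 / t else (1 - p) ^+ 2 / (1 - t)).
  rewrite /erdos_renyi -prodrXl -prodf_div; apply: eq_bigr => e _.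
  by case: (X e).
have a0 : 0 < p ^+ 2 / t by rewrite divr_gt0 ?exprn_gt0//; lra.
have b0 : 0 < (1 - p) ^+ 2 / (1 - t) by rewrite divr_gt0 ?exprn_gt0//; lra.
rewrite prod_edges lnM ?posrE ?exprn_gt0// !lnXn// card_edge.
by rewrite -!(mulr_natl (ln _)) natrB // -card_edge max_card.
Qed.

(** * Comparison of the clique rate with the optimal rate *)

Lemma ln_ge_1sub_inv (R : realType) (x : R) : 0 < x -> 1 - x^-1 <= ln x.
Proof.
move=> x0; have := @le_ln1Dx R (x^-1 - 1).
rewrite subrKC lnV ?posrE// => h; have : 0 < x^-1 by rewrite invr_gt0.
move=> ?; have := h ltac:(lra); lra.
Qed.

(** This gives s ln s >= - 2 sqrt s, with s = r ^ 2, an effective form of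
    s ln s -> 0. *)
Lemma mul_ln_ge (R : realType) (r : R) :
  0 < r -> - (2 * r) <= r ^+ 2 * ln (r ^+ 2).
Proof.
move=> r0; rewrite lnXn// -mulr_natl.
have rr : r * r^-1 = 1 by rewrite divff// gt_eqF.
have := ler_wpM2l (sqr_ge0 r) (ln_ge_1sub_inv R r r0).
by have := sqr_ge0 r; nra.
Qed.

(** The first-order coefficient, in 1 - t, of the gain of the clique. *)
Definition odds_margin {R : realType} (p : R) : R := ln ((1 - p) / p) - 2^-1.

Lemma odds_margin_gt0 (R : realType) (p : R) : 0 < p ->
  p < expR (- 2^-1) / (1 + expR (- 2^-1)) -> 0 < odds_margin p.
Proof.
move=> p0; have e0 := @expR_gt0 R (- 2^-1); rewrite ltr_pdivlMr; last by lra.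
move=> pe; rewrite subr_gt0 -[ltLHS]expRK ltr_ln ?posrE ?expR_gt0//.
  rewrite ltr_pdivlMr// -[2^-1]opprK expRN mulrC ltr_pdivrMr//; lra.
by rewrite divr_gt0//; nra.
Qed.

(** The limit of ln (P(X)^2 / Q(X)) / n^2 along the cliques X on about t n
    vertices. *)
Definition clique_rate {R : realType} (p t : R) : R :=
  2^-1 * (t ^+ 2 * ln (p ^+ 2 / t)
    + (1 - t ^+ 2) * ln ((1 - p) ^+ 2 / (1 - t))).

(** Writing s = 1 - t and D = ln ((1-p) / p), the difference of the two sides is
    s t D + (t - t^2 / 2) ln t + (s^2 / 2) ln s. The bounds ln t >= 1 - 1 / t and
    s ln s >= - 2 sqrt s make it at least s (t (1 + margin) - 1 - sqrt s), which
    is positive when sqrt s < margin / (2 + margin). *)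
Lemma clique_rate_gt (R : realType) (p t : R) :
  0 < p < 1 -> 0 < t < 1 -> 0 < odds_margin p ->
  1 - (odds_margin p / (2 + odds_margin p)) ^+ 2 < t ->
  - 2 * Ip p t < clique_rate p t.
Proof.
rewrite /Ip /clique_rate => /andP[p0 p1] /andP[t0 t1].
have q0 : 0 < 1 - p by lra.
have s0 : 0 < 1 - t by lra.
rewrite /odds_margin !ln_div ?posrE ?exprn_gt0// !lnXn//.
set L := ln p; set M := ln (1 - p).
set del := M - L - 2^-1 => del0 tdel.
pose r := Num.sqrt (1 - t).
have r0 : 0 < r by rewrite sqrtr_gt0.
have rE : r ^+ 2 = 1 - t by rewrite sqr_sqrtr// ltW.
have rdel : r * (2 + del) < del.
  rewrite -ltr_pdivlMr; last by lra.
  rewrite -(@ltr_pXn2r _ 2)// ?nnegrE ?rE; first by lra.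
    exact: ltW.
  by rewrite divr_ge0//; lra.
have lnt := ln_ge_1sub_inv R t t0.
have lns : - (2 * r) <= (1 - t) * ln (1 - t) by rewrite -rE mul_ln_ge.
set l := ln t in lnt *; set lam := ln (1 - t) in lns *.
have tt : t * t^-1 = 1 by rewrite divff// gt_eqF.
have lnt' : - ((1 - t / 2) * (1 - t)) <= (t - t ^+ 2 / 2) * l.
  have : 0 <= t - t ^+ 2 / 2 by nra.
  move=> /ler_wpM2l /(_ _ _ lnt).
  have -> // : (t - t ^+ 2 / 2) * (1 - t^-1) = - ((1 - t / 2) * (1 - t)).
  rewrite -[in RHS](mulr1 (1 - _)) -tt; field; lra.
have lns' : - (r * (1 - t)) <= (1 - t) ^+ 2 * lam / 2.
  by have := ler_wpM2l (ltW s0) lns; lra.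
have r1 : r < 1 by nra.
have main : 0 < (1 - t) * (t * (1 + del) - 1 - r).
  rewrite mulr_gt0//.
  have -> : t = 1 - r ^+ 2 by rewrite rE; ring.
  nra.
have ML : M - L = del + 2^-1 by rewrite /del; ring.
have -> : M = L + (del + 2^-1) by rewrite -ML; ring.
rewrite -subr_gt0.
apply: (lt_le_trans main).
rewrite -subr_ge0.
nra.
Qed.

(** * The clique in the second moment *)

(** The rate of a clique on m = t n + 4 vertices at finite n, except that
    m (m - 1) is replaced by m^2. *)
Definition clique_bound {R : realType} (p t : R) (n : nat) : R :=
  let A := ln (p ^+ 2 / t) in let B := ln ((1 - p) ^+ 2 / (1 - t)) in
  2^-1 * (B * (1 - n%:R^-1) - (t + 4 * n%:R^-1) ^+ 2 * (B - A)).

(** The number m of vertices of the clique must be an integer, so it is only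
    known that t n + 3 <= m <= t n + 4. The upper bound suffices
    because an edge contributes A = ln (p^2 / t), which is at most the
    contribution B = ln ((1-p)^2 / (1-t)) of a missing edge: additional edges
    only lower the weight. *)
Lemma clique_bound_le (R : realType) (p t : R) (n : nat) :
  0 < p <= 2^-1 -> p < t < 1 -> (0 < n)%N -> t * n%:R + 4 <= n%:R ->
  clique_bound p t n <=
  ln (second_moment p t (@edge_tilt R n (logit t))) / n%:R ^+ 2.
Proof.
move=> /andP[p0 p12] /andP[pt t1] n_gt0 tn.
have t0 : 0 < t by lra.
have n0 : 0 < n%:R :> R by rewrite ltr0n.
pose m := (Num.truncn (t * n%:R) + 4)%N.
have [m_ge m_le] : t * n%:R <= m%:R - 3 /\ m%:R <= t * n%:R + 4.
  have /truncn_itv/andP[] : 0 <= t * n%:R by rewrite mulr_ge0// ltW.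
  by rewrite /m natrD -natr1; lra.
have mn : (m <= n)%N by rewrite -(ler_nat R); lra.
have t01 : 0 < t < 1 by rewrite t0.
have p01 : 0 < p < 1 by lra.
have QE : @edge_tilt R n (logit t) = erdos_renyi t.
  by apply/funext => X; exact: edge_tilt_logit.
set A := ln (p ^+ 2 / t); set B := ln ((1 - p) ^+ 2 / (1 - t)).
have AB : A <= B.
  have pp : 0 < p ^+ 2 by rewrite exprn_gt0.
  have qq : 0 < (1 - p) ^+ 2 by rewrite exprn_gt0//; lra.
  rewrite ler_ln ?posrE ?divr_gt0//; last by lra.
  rewrite ler_pdivrMr// mulrAC ler_pdivlMr; last by lra.
  have := mulr_ge0 (ltW qq) (_ : 0 <= t - p); rewrite subr_ge0 (ltW pt).
  have := mulr_ge0 (ltW pp) (_ : 0 <= t - p); rewrite subr_ge0 (ltW pt).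
  have : 0 <= p * (1 - p) * (1 - 2 * p) by rewrite !mulr_ge0//; lra.
  move=> h1 /(_ isT) h2 /(_ isT) h3; lra.
have := @second_moment_ge R n p t (erdos_renyi t) (clique n m).
move=> /(_ (fun Y => ltW (erdos_renyi_gt0 R n t Y t01))).
rewrite gt_eqF ?erdos_renyi_gt0// => /(_ isT).
move=> /(_ (clique_upper_tail R n m t mn n_gt0 (ltW t0) m_ge)) h.
have w0 : 0 < erdos_renyi p (clique n m) ^+ 2 / erdos_renyi t (clique n m).
  by rewrite divr_gt0 ?exprn_gt0// erdos_renyi_gt0.
rewrite QE ler_pdivlMr ?exprn_gt0//.
have : ln (erdos_renyi p (clique n m) ^+ 2 / erdos_renyi t (clique n m)) <=
    ln (second_moment p t (erdos_renyi (n := n) t)).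
  by rewrite ler_ln ?posrE// (lt_le_trans w0).
apply: le_trans.
rewrite ln_weight// num_edges_clique// !bin2r -/A -/B /clique_bound -/A -/B.
have -> : 2^-1 * (B * (1 - n%:R^-1) - (t + 4 * n%:R^-1) ^+ 2 * (B - A))
    * n%:R ^+ 2 =
    2^-1 * (B * (n%:R * (n%:R - 1)) - (t * n%:R + 4) ^+ 2 * (B - A)).
  field; lra.
have mm : m%:R * (m%:R - 1) <= (t * n%:R + 4) ^+ 2.
  have tn0 : 0 < t * n%:R by rewrite mulr_gt0.
  nra.
have : m%:R * (m%:R - 1) * (B - A) <= (t * n%:R + 4) ^+ 2 * (B - A).
  by rewrite ler_wpM2r// subr_ge0.
lra.
Qed.

Lemma clique_bound_cvg (R : realType) (p t : R) :
  (clique_bound p t n @[n --> \oo] --> clique_rate p t)%classic.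
Proof.
rewrite /clique_bound /clique_rate.
set A := ln (p ^+ 2 / t); set B := ln ((1 - p) ^+ 2 / (1 - t)).
have inv0 : ((n%:R^-1 : R) @[n --> \oo] --> (0 : R))%classic.
  apply/gtr0_cvgV0; last exact: cvgr_idn.
  by near=> n; rewrite ltr0n; near: n; exact: nbhs_infty_gt.
have -> : t ^+ 2 * A + (1 - t ^+ 2) * B =
    B * (1 - 0) - (t + 4 * 0) ^+ 2 * (B - A) by ring.
apply: cvgM; first exact: cvg_cst.
apply: cvgB.
  apply: cvgM; first exact: cvg_cst.
  by apply: cvgB => //; exact: cvg_cst.
apply: cvgM; last exact: cvg_cst.
rewrite expr2; under eq_fun do rewrite expr2.
by apply: cvgM; (apply: cvgD; [exact: cvg_cst|
  apply: cvgM => //; exact: cvg_cst]).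
Unshelve. all: by end_near. Qed.

(** * Failure of optimality *)

Theorem proposition3p5 (R : realType) (p : R)
  (p_gt0 : 0 < p) (p_lt : p < expR (- 2^-1) / (1 + expR (- 2^-1))) :
  exists2 t0 : R, t0 < 1 &
    forall t : R, p < t -> t < 1 -> t0 < t ->
      replica_symmetric p t ->
      ~ asymptotically_optimal p t (fun n => @edge_tilt R n (logit t)).
Proof.
have del0 := odds_margin_gt0 R p p_gt0 p_lt.
have p12 : p <= 2^-1.
  have e0 := @expR_gt0 R (- 2^-1).
  have e1 : expR (- 2^-1) < 1 :> R by rewrite expR_lt1; lra.
  move: p_lt; rewrite ltr_pdivlMr; last by lra.
  nra.
exists (1 - (odds_margin p / (2 + odds_margin p)) ^+ 2).
  by rewrite ltrBlDr ltrDl exprn_gt0// divr_gt0//; lra.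
move=> t pt t1 tdel [infE _] opt; rewrite /asymptotically_optimal infE in opt.
have := @clique_rate_gt R p t ltac:(lra) ltac:(lra) del0 tdel.
rewrite ltNge => /negP; apply.
apply: ler_cvg_to (clique_bound_cvg R p t) opt _.
(* The clique fits in the graph, t n + 4 <= n, once n >= 4 / (1 - t). *)
near=> n; apply: clique_bound_le; [lra|lra|by near: n; exact: nbhs_infty_gt|].
have : 4 / (1 - t) <= n%:R by near: n; exact: nbhs_infty_ger.
by rewrite ler_pdivrMr; lra.
Unshelve. all: by end_near. Qed.
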